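(* For any two non-trivial finite simple connected graphs $G$ and $H$, $$\gamma_{P,c}(G\,\square\,H)\leq \min\{\gamma_{P,c}(G)\,|V(H)|,\ \gamma_{P,c}(H)\,|V(G)|\}.$$
   Context: For a graph $G$ and $S\subseteq V(G)$, the set $M(S)$ of vertices monitored by $S$ is built as follows: initially $M(S)=N[S]$; then, as long as there is a vertex $v\in M(S)$ with exactly one neighbour $w$ outside $M(S)$, add $w$ to $M(S)$. $S$ is a connected power dominating set if $M(S)=V(G)$ and the induced subgraph $\langle S\rangle$ is connected; $\gamma_{P,c}(G)$ is the minimum cardinality of such a set. The Cartesian product $G\,\square\,H$ has vertex set $V(G)\times V(H)$, with $(a,b)$ adjacent to $(x,y)$ iff either $a=x$ and $by\in E(H)$, or $b=y$ and $ax\in E(G)$. *)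

(* Defs.v *)
From mathcomp Require Import all_boot.

Set Implicit Arguments.
Unset Strict Implicit.
Unset Printing Implicit Defensive.

Record sgraph := SGraph {
  vertex :> finType;
  adj : rel vertex;
  adj_sym : symmetric adj;
  adj_irrefl : irreflexive adj }.

Section PowerDomination.
Variable G : sgraph.
Implicit Types (S X Y : {set G}) (v w : G).

Definition nbhd v : {set G} := [set w | adj v w].

Definition closed_nbhd S : {set G} := S :|: \bigcup_(v in S) nbhd v.

Definition induced_adj S : rel G :=
  [rel v w | [&& v \in S, w \in S & adj v w]].

(* The empty set counts as connected here; this is harmless below, since the
   empty set monitors no vertex. *)
Definition induced_connected S : bool :=
  [forall v in S, forall w in S, connect (induced_adj S) v w].

Definition connected_graph : bool := (0 < #|G|) && induced_connected [set: G].

Definition nontrivial_graph : bool := 1 < #|G|.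

Definition forces X w : bool :=
  [exists v in X, nbhd v :\: X == [set w]].

(* The vertex to add is chosen arbitrarily when several are possible; by
   [monitored_run] the final set does not depend on these choices. *)
Definition monitor_step X : {set G} :=
  if [pick w | forces X w] is Some w then w |: X else X.

(* Each step before stabilisation adds a vertex, so #|G| steps reach the end of
   the process ([monitored_stable]). *)
Definition monitored S : {set G} := iter #|G| monitor_step (closed_nbhd S).

Definition conn_power_dominating S : bool :=
  (monitored S == [set: G]) && induced_connected S.

(* #|G| is only a default value for the minimum over an empty family: if G is
   connected then the full vertex set is admissible and the minimum is attained
   ([gamma_Pc_attained]). *)
Definition gamma_Pc : nat :=
  \big[minn/#|G|]_(S : {set G} | conn_power_dominating S) #|S|.

Inductive monitor_run S : {set G} -> Prop :=
| run_start : monitor_run S (closed_nbhd S)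
| run_add X w : monitor_run S X -> forces X w -> monitor_run S (w |: X).

Lemma forces_notin X w : forces X w -> w \notin X.
Proof.
by case/existsP=> v /andP[_ /eqP E]; move: (set11 w); rewrite -E inE; case/andP.
Qed.

Lemma forces_mono X Y w :
  X \subset Y -> forces X w -> w \notin Y -> forces Y w.
Proof.
move=> sXY /existsP[v /andP[vX /eqP E]] wY; apply/existsP; exists v.
rewrite (subsetP sXY) //=; apply/eqP/setP => u; rewrite !inE.
have := set11 w; rewrite -E !inE => /andP[_ vw].
apply/andP/eqP => [[uY vu]|->] //; apply/set1P; rewrite -E !inE vu andbT.
exact: contra (subsetP sXY u) uY.
Qed.

Lemma monitored_run_in S : monitor_run S (monitored S).
Proof.
rewrite /monitored; elim: #|G| => [|n IH] /=; first exact: run_start.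
by rewrite /monitor_step; case: pickP => [w /run_add|_] //; apply.
Qed.

Lemma monitored_stable S w : ~~ forces (monitored S) w.
Proof.
pose X n := iter n monitor_step (closed_nbhd S).
have grow n : (forall w, ~~ forces (X n) w) \/ n <= #|X n|.
  elim: n => [|n IH]; first by right.
  rewrite /X /= -/(X n) /monitor_step; case: pickP => [u fu|nf].
    by case: IH => [/(_ u)|IH]; [rewrite fu | right; rewrite cardsU1 forces_notin].
  by left => u; rewrite nf.
have [-> //|le] := grow #|G|.
apply/negP => /forces_notin; rewrite -[monitored S]/(X #|G|).
have /eqP-> : X #|G| == [set: G] by rewrite eqEcard subsetT cardsT.
by rewrite inE.
Qed.

Lemma run_subset S X Y :
  monitor_run S X -> monitor_run S Y -> (forall w, ~~ forces Y w) -> X \subset Y.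
Proof.
move=> runX runY stY; elim: runX => [|Z w _ IH fw].
  elim: runY {stY} => [//|Z w _ IH _]; exact: subset_trans IH (subsetUr _ _).
rewrite subUset IH andbT sub1set; apply: contraT => wY.
by have := stY w; rewrite (forces_mono IH fw wY).
Qed.

Lemma monitored_run S X :
  monitor_run S X -> (forall w, ~~ forces X w) -> monitored S = X.
Proof.
move=> runX stX; apply/eqP; rewrite eqEsubset.
rewrite (run_subset (monitored_run_in S) runX stX) /=.
exact: run_subset runX (monitored_run_in S) (@monitored_stable S).
Qed.

Lemma gamma_Pc_le S : conn_power_dominating S -> gamma_Pc <= #|S|.
Proof.
move=> cS; rewrite /gamma_Pc; have := mem_index_enum S.
elim: (index_enum _) => //= X r IH; rewrite inE big_cons.
case/predU1P=> [<-|/IH le]; first by rewrite cS geq_minl.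
by case: ifP => // _; rewrite geq_min le orbT.
Qed.

Lemma gamma_Pc_attained :
  connected_graph -> exists2 S, conn_power_dominating S & #|S| = gamma_Pc.
Proof.
case/andP=> _ cG; rewrite /gamma_Pc.
apply: (big_ind (fun n => exists2 S, conn_power_dominating S & #|S| = n)).
- exists [set: G]; last by rewrite cardsT.
  rewrite /conn_power_dominating cG andbT -subTset.
  have: [set: G] \subset closed_nbhd [set: G] by exact: subsetUl.
  move/subset_trans; apply; apply: run_subset (run_start _) (monitored_run_in _) _.
  exact: monitored_stable.
- by move=> m n Hm Hn; rewrite /minn; case: ifP.
- by move=> S cS; exists S.
Qed.

End PowerDomination.

Section CartesianProduct.
Variables G H : sgraph.

Definition cart_adj : rel (G * H) :=
  [rel p q | ((p.1 == q.1) && adj p.2 q.2) || ((p.2 == q.2) && adj p.1 q.1)].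

Lemma cart_adj_sym : symmetric cart_adj.
Proof.
by move=> p q; rewrite /cart_adj /= adj_sym [adj p.1 _]adj_sym [p.1 == _]eq_sym [p.2 == _]eq_sym.
Qed.

Lemma cart_adj_irrefl : irreflexive cart_adj.
Proof. by move=> p; rewrite /cart_adj /= !adj_irrefl !andbF. Qed.

Definition cart_prod : sgraph := SGraph cart_adj_sym cart_adj_irrefl.

End CartesianProduct.

Notation "G □ H" := (cart_prod G H) (at level 40, left associativity).

(* Main.v *)
(** If [S] is a connected power dominating set of [G], its cylinder
    [S * V(H)] is one of [G □ H], because every forcing step of [G] can be
    performed in all the copies of [G] in parallel: when [w] is the only
    neighbour of [v] outside [X], the only neighbour of [(v, h)] outside
    [X * V(H)] is [(w, h)]. To treat both factors at once, this is proved for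
    the preimage of [S] under a projection [p : K -> G] that retains only the
    relevant features of [fst] and [snd]. *)

Require Import Defs.
From mathcomp Require Import all_boot.

Set Implicit Arguments.
Unset Strict Implicit.
Unset Printing Implicit Defensive.

Definition fibre_adj (K G : sgraph) (p : K -> G) : rel K :=
  [rel x y | (p x == p y) && adj x y].

(** Edges of [K] collapse or map to edges, and an edge of [G] at [p x] has exactly one lift at [x]:
    this transports domination and forcing. Connected fibres serve the connectedness of
    preimages. *)
Record projection (K G : sgraph) (p : K -> G) : Prop := Projection {
  proj_adj : forall x y, adj x y -> p x != p y -> adj (p x) (p y);
  proj_lift : forall x a, adj (p x) a -> exists2 y, adj x y & p y = a;
  proj_lift_inj : forall x y z, adj x y -> adj x z -> p x != p y ->
    p y = p z -> y = z;
  proj_fibre : forall x y, p x = p y -> connect (fibre_adj p) x y }.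

Section Lift.
Variables (K G : sgraph) (p : K -> G).
Hypothesis projp : projection p.

Lemma closed_nbhd_preim (S : {set G}) :
  p @^-1: closed_nbhd S \subset closed_nbhd (p @^-1: S).
Proof.
apply/subsetP=> x; rewrite !inE => /orP[->//|/bigcupP[v vS]].
rewrite inE adj_sym => /(proj_lift projp)[y xy pyv].
by apply/orP; right; apply/bigcupP; exists y; rewrite inE ?pyv // adj_sym.
Qed.

(** [Y] may exceed the preimage of [X] because the vertices over [p x] are added one at a time, so
    some of them may already be monitored. *)
Lemma forces_preim (X : {set G}) (Y : {set K}) (x : K) :
  p @^-1: X \subset Y -> forces X (p x) -> x \notin Y -> forces Y x.
Proof.
move=> sXY fx xY; have pxX := forces_notin fx.
case/existsP: fx => v /andP[vX /eqP E].
have := set11 (p x); rewrite -E !inE => /andP[_].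
(* The vertex forcing [x] is the neighbour [y] of [x] over [v]. *)
rewrite adj_sym => /(proj_lift projp)[y xy pyv].
have pyx: p y != p x by apply: contraNneq pxX => <-; rewrite pyv.
have yx: adj y x by rewrite adj_sym.
apply/existsP; exists y; rewrite (subsetP sXY) ?inE ?pyv //=.
apply/eqP/setP => z; rewrite !inE.
apply/andP/eqP => [[zY yz]|->] //.
(* A neighbour [z] of [y] outside [Y] lies over a neighbour of [v] outside [X], hence over [p x];
   uniqueness of lifts at [y] gives [z = x]. *)
have pzX: p z \notin X by apply: contra zY => pzX; rewrite (subsetP sXY) ?inE.
have pyz: p y != p z by apply: contraNneq pzX => <-; rewrite pyv.
have pzx: p z = p x.
  by apply/set1P; rewrite -E !inE pzX -pyv (proj_adj projp).
exact: (proj_lift_inj projp yz yx).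
Qed.

(** Induction on a run in [G]. The target set is stable in [K], so it already contains every vertex
    it could force, and no run in [K] has to be scheduled. *)
Lemma monitored_preim (S : {set G}) :
  p @^-1: monitored S \subset monitored (p @^-1: S).
Proof.
elim: (monitored_run_in S) => [|X w _ IH fw].
  apply: subset_trans (closed_nbhd_preim S) _.
  exact: run_subset (run_start _) (monitored_run_in _) (@monitored_stable _ _).
apply/subsetP => x; rewrite !inE => /predU1P[pxw|pxX]; last first.
  by rewrite (subsetP IH) ?inE.
apply: contraT => xM; rewrite -pxw in fw.
by have := monitored_stable (p @^-1: S) x; rewrite (forces_preim IH fw xM).
Qed.

(** A path in [S] from [p x] to [p y] lifts edge by edge from [x]; its end shares the fibre of [y],
    and a path inside that fibre completes it. *)
Lemma induced_connected_preim (S : {set G}) :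
  induced_connected S -> induced_connected (p @^-1: S).
Proof.
move=> cS; apply/forall_inP => x; rewrite inE => xS.
apply/forall_inP => y; rewrite inE => yS.
have /connectP[s] := forall_inP (forall_inP cS _ xS) _ yS.
elim: s x xS => [|a s IH] x xS /=.
  move=> _ pyx; have /connectP[t] := proj_fibre projp (esym pyx).
  elim: t x xS {pyx} => [|z t IH] x xS /=; first by move=> _ ->.
  case/andP=> /andP[/eqP xz adjxz] pt yE.
  have zS: p z \in S by rewrite -xz.
  apply: connect_trans (IH z zS pt yE); apply: connect1.
  by rewrite /induced_adj /= !inE xS zS.
case/andP=> /and3P[_ aS /(proj_lift projp)[z xz pza]].
rewrite -pza in aS *; move=> ps yE.
apply: connect_trans (IH z aS ps yE); apply: connect1.
by rewrite /induced_adj /= !inE xS aS.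
Qed.

Lemma conn_power_dominating_preim (S : {set G}) :
  conn_power_dominating S -> conn_power_dominating (p @^-1: S).
Proof.
case/andP=> /eqP mS /induced_connected_preim cS.
by rewrite /conn_power_dominating cS -subTset -(preimsetT p) -mS monitored_preim.
Qed.

End Lift.

Section Projections.
Variables G H : sgraph.

Lemma connected_graphP (K : sgraph) :
  connected_graph K -> forall x y : K, connect (@adj K) x y.
Proof.
case/andP=> _ cK x y.
have := forall_inP (forall_inP cK x (in_setT x)) y (in_setT y).
by apply: connect_sub => u v /and3P[_ _ uv]; apply: connect1.
Qed.

Lemma projection_fst :
  connected_graph H -> @projection (G □ H) G (fun x => x.1).
Proof.
move=> cH; split=> [x y /orP[/andP[-> //]|/andP[]//]|[x1 x2] a /= xa||].
- by exists (a, x2); rewrite //= /cart_adj /= eqxx xa orbT.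
(* Both edges change the first coordinate, so both keep the second one, [x2]. *)
- move=> [x1 x2] [y1 y2] [z1 z2] /= xy xz /negPf nxy yz.
  by move: xy xz; rewrite -yz /= /cart_adj /= nxy /= => /andP[/eqP <- _] /andP[/eqP <- _].
(* The fibre is a copy of [H]: a path of [H] is followed with [x1] fixed. *)
move=> [x1 x2] [y1 y2] /= <-.
have /connectP[s] := connected_graphP cH x2 y2.
elim: s x2 => [|a s IH] x2 /=; first by move=> _ ->.
case/andP=> xa ps yE; apply: connect_trans (IH a ps yE).
by apply: connect1; rewrite /fibre_adj /= /cart_adj /= !eqxx xa.
Qed.

Lemma projection_snd :
  connected_graph G -> @projection (G □ H) H (fun x => x.2).
Proof.
move=> cG; split=> [x y /orP[/andP[]//|/andP[-> //]]|[x1 x2] a /= xa||].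
- by exists (x1, a); rewrite //= /cart_adj /= eqxx xa.
- move=> [x1 x2] [y1 y2] [z1 z2] /= xy xz /negPf nxy yz.
  by move: xy xz; rewrite -yz /= /cart_adj /= nxy /= !orbF => /andP[/eqP <- _] /andP[/eqP <- _].
move=> [x1 x2] [y1 y2] /= <-.
have /connectP[s] := connected_graphP cG x1 y1.
elim: s x1 => [|a s IH] x1 /=; first by move=> _ ->.
case/andP=> xa ps yE; apply: connect_trans (IH a ps yE).
by apply: connect1; rewrite /fibre_adj /= /cart_adj /= !eqxx xa orbT.
Qed.

End Projections.

Theorem theorem2 (G H : sgraph)
    (ntG : nontrivial_graph G) (cG : connected_graph G)
    (ntH : nontrivial_graph H) (cH : connected_graph H) :
  gamma_Pc (G □ H) <= minn (gamma_Pc G * #|H|) (gamma_Pc H * #|G|).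
Proof.
rewrite leq_min; apply/andP; split.
- have [S /(conn_power_dominating_preim (projection_fst G cH)) cS <-] :=
    gamma_Pc_attained cG.
  (* The cylinder is bounded by the product set of [S] and all of [H]. *)
  apply: leq_trans (gamma_Pc_le cS) _; rewrite -cardsT -cardsX.
  by apply/subset_leq_card/subsetP => x; rewrite !inE andbT.
have [S /(conn_power_dominating_preim (projection_snd H cG)) cS <-] :=
  gamma_Pc_attained cH.
apply: leq_trans (gamma_Pc_le cS) _; rewrite mulnC -cardsT -cardsX.
by apply/subset_leq_card/subsetP => x; rewrite !inE.
Qed.
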